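(* Let $R$ be a PVMD with quotient field $K$, let $I$ be a radical $t$-ideal of $R$ (that is, a $t$-ideal with $I=\sqrt{I}$), let $\{P_\alpha\}$ be the set of all minimal prime ideals of $I$, and assume that the intersection $\bigcap_\alpha P_\alpha$ is irredundant. Then $I^{-1}$ is a subring of $K$ if and only if $P_\alpha$ is not $t$-invertible for each $\alpha$.
   Context: Let $R$ be an integral domain with quotient field $K$. For nonzero fractional ideals $I,J$ of $R$, $(I:J)=\{x\in K : xJ\subseteq I\}$ and $I^{-1}=(R:I)$. The $v$-closure is $I_v=(I^{-1})^{-1}$ and the $t$-closure is $I_t=\bigcup J_v$, where $J$ ranges over the nonzero finitely generated subideals of $I$. A $t$-ideal of $R$ is a nonzero ideal $I\subseteq R$ with $I=I_t$. A fractional ideal $I$ is $t$-invertible if $(II^{-1})_t=R$. $R$ is a PVMD (Prüfer $v$-multiplication domain) if every nonzero finitely generated ideal of $R$ is $t$-invertible. The intersection $\bigcap_\alpha P_\alpha$ is irredundant if no $P_\alpha$ can be omitted, i.e. for each $\alpha$, $\bigcap_{\gamma\ne\alpha}P_\gamma\neq\bigcap_{\gamma}P_\gamma$ (an empty intersection being $R$). *)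

(* Defs.v *)
From mathcomp Require Import all_boot all_order all_algebra.
From mathcomp Require Import boolp classical_sets.

Set Implicit Arguments.
Unset Strict Implicit.
Unset Printing Implicit Defensive.

Import GRing.Theory.
Local Open Scope classical_set_scope.
Local Open Scope ring_scope.

Notation toK := FracField.tofrac.

Definition nonzero_set (V : nmodType) (A : set V) : Prop :=
  exists2 x, A x & x != 0.

Section FractionalIdeals.
Variable R : idomainType.
Local Notation K := {fraction R}.
Implicit Types I J : set K.

(* R viewed inside its quotient field *)
Definition baseK : set K := range (@toK R).

(* The operations below are total on subsets of K; they have their usual
   meaning on nonzero fractional ideals, the only sets they are applied to. *)

Definition colonK I J : set K := [set x | forall y, J y -> I (x * y)].

Definition invK I : set K := colonK baseK I.

Definition vclosure I : set K := invK (invK I).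

Definition spanK (s : seq K) : set K :=
  [set x | exists c : 'I_(size s) -> R,
     x = \sum_(i < size s) toK (c i) * s`_i].

Definition fin_gen J : Prop := exists s : seq K, J = spanK s.

Definition tclosure I : set K :=
  [set x | exists J,
     [/\ fin_gen J, nonzero_set J, J `<=` I & vclosure J x]].

Definition prodK I J : set K :=
  [set x | exists n (a b : 'I_n -> K),
     [/\ forall i, I (a i), forall i, J (b i) & x = \sum_(i < n) a i * b i]].

Definition t_invertible I : Prop := tclosure (prodK I (invK I)) = baseK.

End FractionalIdeals.

Section Ideals.
Variable R : idomainType.
Implicit Types (A P : set R) (F : set (set R)).

Definition idealK A : set {fraction R} := @toK R @` A.

(* idealr_closed is not used here because it excludes the unit ideal *)
Definition is_ideal A : Prop := GRing.submod_closed ([in A] : {pred R^o}).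

Definition is_prime_ideal P : Prop :=
  idealr_closed [in P] /\ prime_idealr_closed [in P].

Definition t_ideal A : Prop :=
  [/\ is_ideal A, nonzero_set A & idealK A = tclosure (idealK A)].

Definition radical A : set R :=
  [set x | exists2 n, (0 < n)%N & A (x ^+ n)].

Definition minimal_primes A : set (set R) :=
  [set P | [/\ is_prime_ideal P, A `<=` P &
     forall Q, is_prime_ideal Q -> A `<=` Q -> Q `<=` P -> Q = P]].

(* An intersection over an empty family is the whole ring. *)
Definition irredundant F : Prop :=
  forall P, F P -> \bigcap_(Q in F `\ P) Q <> \bigcap_(Q in F) Q.

End Ideals.

Definition is_PVMD (R : idomainType) : Prop :=
  forall A : set R, is_ideal A -> nonzero_set A -> fin_gen (idealK A) ->
    t_invertible (idealK A).

(* Main.v *)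
Require Import Defs.
From mathcomp Require Import all_boot all_order all_algebra.
From mathcomp Require Import ring.
From mathcomp Require Import boolp classical_sets.

Import GRing.Theory.
Local Open Scope classical_set_scope.
Local Open Scope ring_scope.

(** Throughout, P is a minimal prime of I and j is an element outside P with
    j P contained in I; irredundance of the intersection of the minimal primes
    provides it, any element of the other minimal primes outside P being such
    a j, since a radical ideal is the intersection of its minimal primes
    ([irredundant_witness]).

    Both directions turn on whether P P^-1 is contained in P.

    If P is t-invertible, then P P^-1 is not contained in P
    ([t_invertible_minimal_prime]): otherwise 1 would lie in P_t, whereas a
    finitely generated subideal J of P is carried into I by some t outside P
    (an element of a minimal prime of a radical ideal is annihilated modulo I
    by an element outside the prime), so that 1 in J_v would give
    t in (t J)_v, hence t in I_t = I.  Take p in P and y in P^-1 with r = y p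
    outside P.  As P^-1 is contained in I^-1, if the latter is a ring it
    contains y^2; since j p is in I, the element y^2 (j p) is in R, and
    multiplying it by p puts j r^2 in P, although neither j nor r is in P.

    Conversely, if no P is t-invertible, then I^-1 I is contained in I, which
    makes I^-1 a ring.  Indeed let x be in I^-1 and a in I, and suppose that
    x a is outside P.  Then y = x j is in P^-1 and y a = (x a) j is outside P.
    In a PVMD such a pair forces P to be t-invertible
    ([t_invertible_of_dual_escape]): writing r = y a, the ideal A = (a, r) is
    t-invertible, and A A^-1 is contained in P P^-1. *)

(** * Minimal primes of a radical ideal *)

Section MinimalPrimes.
Context {R : idomainType}.
Implicit Types (A I P S : set R).

Lemma is_idealP A : is_ideal A <->
  [/\ A 0, forall a b, A a -> A b -> A (a + b) & forall c a, A a -> A (c * a)].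
Proof.
split=> [[]|[A0 AD AM]].
  rewrite in_setE => A0 AL.
  have AM c a : A a -> A (c * a).
    move=> Aa; have := AL c a 0; rewrite !in_setE addr0; exact.
  split=> // a b Aa Ab.
  by have := AL 1 a b; rewrite !in_setE scale1r; apply.
split; first by rewrite in_setE.
by move=> c a b; rewrite !in_setE => Aa Ab; apply: AD => //; apply: AM.
Qed.

Lemma is_prime_idealP P : is_prime_ideal P <->
  [/\ is_ideal P, ~ P 1 & forall a b, P (a * b) -> P a \/ P b].
Proof.
split=> [[[P0 P1 PL] PM]|[/is_idealP[P0 PD PM] P1 Pp]].
  split; first by split.
    by move: P1 => /negP; rewrite in_setE.
  move=> a b Pab; have := PM a b; rewrite !in_setE => /(_ Pab) /orP.
  by rewrite !in_setE.
split.
  split; rewrite ?in_setE //.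
    by apply/negP; rewrite in_setE.
  by move=> c a b; rewrite !in_setE => Pa Pb; apply: PD => //; apply: PM.
move=> a b; rewrite in_setE => /Pp[] Pa; apply/orP; rewrite !in_setE; tauto.
Qed.

Definition mult_set S := S 1 /\ forall a b, S a -> S b -> S (a * b).

Lemma prime_mult_set P : is_prime_ideal P -> mult_set (~` P).
Proof. by move=> /is_prime_idealP[_ P1 PM]; split=> // a b Pa Pb /PM[]. Qed.

(** Zorn's lemma is applied to the sets N whose union with S is multiplicative
    and disjoint from I, rather than to the sets containing S, so that the
    empty chain needs no separate treatment. *)
Lemma maximal_mult_set I S : mult_set S -> S `&` I = set0 ->
  exists M, [/\ mult_set M, S `<=` M, M `&` I = set0 &
    forall N, mult_set N -> M `<=` N -> N `&` I = set0 -> N `<=` M].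
Proof.
move=> [S1 SM] SI.
pose good N := mult_set (N `|` S) /\ (N `|` S) `&` I = set0.
have [F Fgood Ftot|M [[Mm MI] Mmax]] := @Zorn_bigcup R good.
  have common a b : (\bigcup_(N in F) N `|` S) a ->
      (\bigcup_(N in F) N `|` S) b ->
      (S a /\ S b) \/ exists2 N, F N & (N `|` S) a /\ (N `|` S) b.
    move=> [[N FN Na]|Sa] [[N' FN' N'b]|Sb]; last by left.
    - right; have [NN'|N'N] := Ftot N N' FN FN'.
        by exists N' => //; split; left => //; exact: NN'.
      by exists N => //; split; left => //; exact: N'N.
    - by right; exists N => //; split; [left|right].
    - by right; exists N' => //; split; [right|left].
  split.
    split; first by right.
    move=> a b /common/[apply] -[[Sa Sb]|[N FN [Na Nb]]].
      by right; apply: SM.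
    have [[_ NM] _] := Fgood N FN.
    by have [Nab|Sab] := NM a b Na Nb; [left; exists N|right].
  apply/seteqP; split=> // a [[[N FN Na]|Sa] Ia].
    have [_ <-] := Fgood N FN.
    by split=> //; left.
  by rewrite -SI.
exists (M `|` S); split=> // N Nm MN NI.
have NS : N `|` S = N by apply/setUidl => a Sa; apply: MN; right.
move=> a Na; left; apply: contrapT => Ma.
apply: (Mmax N); last by rewrite /good NS.
split; first by move=> b Mb; apply: MN; left.
by move=> /(_ a Na).
Qed.

(** The power (s a)^(n+1) is a multiple of s a^(n+1). *)
Lemma radical_cancel_exp I s a n : is_ideal I -> I = radical I ->
  I (s * a ^+ n.+1) -> I (s * a).
Proof.
move=> /is_idealP[_ _ IM] Irad Isa; rewrite Irad; exists n.+1 => //.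
by rewrite exprMn exprSr -mulrA; apply: IM.
Qed.

(** The complement of a maximal multiplicative set M disjoint from I is a minimal
    prime.  Adjoining to M an element outside it must produce an element of I,
    so the complement of M consists of the a with s a in I for some s in M; this
    description makes it an ideal, and forces any prime between I and the
    complement to be all of it.  Using multiplicative sets instead of ideals
    yields minimality and primality from a single application of Zorn's lemma. *)
Lemma minimal_prime_avoiding I S :
  is_ideal I -> I = radical I -> mult_set S -> S `&` I = set0 ->
  exists2 P, minimal_primes I P & S `&` P = set0.
Proof.
move=> Iid Irad Sm SI; have [I0 ID IM] := (is_idealP I).1 Iid.
have [M [[M1 MM] SM MI Mmax]] := maximal_mult_set I S Sm SI.
have MnI a : M a -> I a -> False.
  by move=> Ma Ia; have : (M `&` I) a by []; rewrite MI.
have compl a : ~ M a -> exists2 s, M s & I (s * a).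
  move=> Ma; apply: contrapT => noS; apply: Ma.
  (* N is the multiplicative set generated by M and a. *)
  pose N := [set x | exists2 s, M s & exists n, x = s * a ^+ n].
  apply: (Mmax N) => //; last by exists 1 => //; exists 1; rewrite mul1r.
  - split; first by exists 1 => //; exists 0; rewrite mulr1.
    move=> _ _ [s Ms [n ->]] [t Mt [m ->]].
    by exists (s * t); [exact: MM|exists (n + m)%N; rewrite exprD; ring].
  - by move=> s Ms; exists s => //; exists 0; rewrite mulr1.
  - apply/seteqP; split=> // _ [[s Ms [[|n] ->]]].
      by rewrite mulr1 => /(MnI s Ms).
    by move=> /(radical_cancel_exp I s a n Iid Irad) Isa; case: noS; exists s.
have complI s a : M s -> I (s * a) -> ~ M a.
  by move=> Ms Isa Ma; apply: MnI (MM _ _ Ms Ma) Isa.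
exists (~` M); last first.
  by apply/seteqP; split=> // a [Sa Ma]; apply/Ma/SM.
split.
- apply/is_prime_idealP; split; last 2 first.
  + by move=> /(_ M1).
  + move=> a b Mab; apply: contrapT => /not_orP[/contrapT Ma /contrapT Mb].
    by apply: Mab; apply: MM.
  apply/is_idealP; split=> [/MnI/(_ I0)//|a b|c a].
    move=> /compl[s Ms Isa] /compl[t Mt Itb].
    apply: (complI (s * t)); first exact: MM.
    have -> : s * t * (a + b) = t * (s * a) + s * (t * b) by ring.
    by apply: ID; apply: IM.
  move=> /compl[s Ms Isa]; apply: (complI s) => //.
  by rewrite mulrCA; apply: IM.
- by move=> a Ia Ma; apply: MnI Ma Ia.
- move=> Q /is_prime_idealP[Qid _ Qp] IQ QM; apply/seteqP; split=> // a.
  move=> /compl[s Ms /IQ /Qp[Qs|//]]; by case: (QM s Qs).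
Qed.

(** This says that I and P agree after localization at P.  Otherwise the
    multiplicative set of the s a^n with s outside P would be disjoint from I,
    and a minimal prime avoiding it would lie inside P and miss a. *)
Lemma minimal_prime_annihilated I P a :
  is_ideal I -> I = radical I -> minimal_primes I P -> P a ->
  exists2 s, ~ P s & I (s * a).
Proof.
move=> Iid Irad [Pp IP Pmin] Pa; apply: contrapT => noS.
have [P1 PM] := prime_mult_set P Pp.
pose N := [set x | exists2 s, ~ P s & exists n, x = s * a ^+ n].
have [||Q [Qp IQ _] NQ] := minimal_prime_avoiding I N Iid Irad.
- split; first by exists 1 => //; exists 0; rewrite mulr1.
  move=> _ _ [s Ps [n ->]] [t Pt [m ->]].
  by exists (s * t); [exact: PM|exists (n + m)%N; rewrite exprD; ring].
- apply/seteqP; split=> // _ [[s Ps [[|n] ->]]].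
    by rewrite mulr1 => /IP.
  by move=> /(radical_cancel_exp I s a n Iid Irad) Isa; case: noS; exists s.
have QN x : Q x -> ~ N x by move=> Qx Nx; have : (N `&` Q) x by []; rewrite NQ.
have QP : Q `<=` P.
  move=> x Qx; apply: contrapT => Px; apply: (QN x Qx).
  by exists x => //; exists 0; rewrite mulr1.
apply: (QN a); first by rewrite (Pmin Q Qp IQ QP).
by exists 1 => //; exists 1; rewrite mul1r.
Qed.

Lemma bigcap_minimal_primes I : is_ideal I -> I = radical I ->
  \bigcap_(P in minimal_primes I) P = I.
Proof.
move=> Iid Irad; have [I0 ID IM] := (is_idealP I).1 Iid.
apply/seteqP; split=> [x Px|x Ix P [_ + _]]; last exact.
apply: contrapT => Ix.
have [||P IP] := minimal_prime_avoiding I (range (fun n => x ^+ n)) Iid Irad.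
- split; first by exists 0.
  by move=> _ _ [n _ <-] [m _ <-]; exists (n + m)%N => //; rewrite exprD.
- apply/seteqP; split=> // _ [[[|n] _ <-]].
    by rewrite expr0 => /(IM x); rewrite mulr1.
  by move=> Ixn; apply: Ix; rewrite Irad; exists n.+1.
apply/eqP/set0P; exists x; split; last exact: Px.
by exists 1.
Qed.

(** The element j is taken in all the other minimal primes but not in P; then
    j p lies in every minimal prime, hence in I. *)
Lemma irredundant_witness I P : is_ideal I -> I = radical I ->
  irredundant (minimal_primes I) -> minimal_primes I P ->
  exists2 j, ~ P j & forall p, P p -> I (j * p).
Proof.
move=> Iid Irad Iirr IP.
have [j [Jj Pj]] : exists j, (\bigcap_(Q in minimal_primes I `\ P) Q) j /\ ~ P j.
  apply: contrapT => noj; apply: (Iirr P IP); apply/seteqP.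
  split=> [j Jj Q IQ|j Jj Q [IQ _]]; last exact: Jj.
  have [->|QP] := pselect (Q = P); last exact: Jj.
  by apply: contrapT => Pj; apply: noj; exists j.
exists j => // p Pp; rewrite -(bigcap_minimal_primes I Iid Irad) => Q IQ.
have /is_prime_idealP[/is_idealP[_ _ QM] _ _] : is_prime_ideal Q by case: IQ.
have [->|QP] := pselect (Q = P).
  by have [/is_prime_idealP[/is_idealP[_ _ PM] _ _] _ _] := IP; apply: PM.
by rewrite mulrC; apply: QM; apply: Jj.
Qed.

End MinimalPrimes.

(** * Fractional ideals and the t-closure *)

Section Duals.
Context {R : idomainType}.
Local Notation K := {fraction R}.
Implicit Types (A I P : set R) (B C J : set K).

Lemma toK_inj : injective (@toK R).
Proof. by move=> a b /eqP; rewrite tofrac_eq => /eqP. Qed.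

Lemma baseKM (x y : K) : baseK x -> baseK y -> baseK (x * y).
Proof. by move=> [a _ <-] [b _ <-]; exists (a * b) => //; rewrite tofracM. Qed.

Lemma baseKB (x y : K) : baseK x -> baseK y -> baseK (x - y).
Proof. by move=> [a _ <-] [b _ <-]; exists (a - b) => //; rewrite tofracB. Qed.

Lemma idealK_toK A a : idealK A (toK a) <-> A a.
Proof. by split=> [[b Ab /toK_inj <-]|Aa] //; exists a. Qed.

Lemma idealK_sub A : idealK A `<=` @baseK R.
Proof. by move=> _ [a _ <-]; exists a. Qed.

Lemma idealKD A x y : is_ideal A -> idealK A x -> idealK A y -> idealK A (x + y).
Proof.
move=> /is_idealP[_ AD _] [a Aa <-] [b Ab <-].
by exists (a + b); [exact: AD|rewrite tofracD].
Qed.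

Lemma idealKM A c x : is_ideal A -> idealK A x -> idealK A (toK c * x).
Proof.
move=> /is_idealP[_ _ AM] [a Aa <-].
by exists (c * a); [exact: AM|rewrite tofracM].
Qed.

Lemma idealK_sum A n (F : 'I_n -> K) : is_ideal A ->
  (forall i, idealK A (F i)) -> idealK A (\sum_i F i).
Proof.
move=> Aid AF; apply: (big_ind (idealK A)) => //.
  by have /is_idealP[A0 _ _] := Aid; exists 0; rewrite ?tofrac0.
by move=> x y; apply: idealKD.
Qed.

Lemma mem_prodK B C b c : B b -> C c -> prodK B C (b * c).
Proof.
move=> Bb Cc; exists 1%N, (fun=> b), (fun=> c); split=> //.
by rewrite big_ord1.
Qed.

Lemma prodKD B C x y : prodK B C x -> prodK B C y -> prodK B C (x + y).
Proof.
move=> [k [a1 [b1 [Ba1 Cb1 ->]]]] [l [a2 [b2 [Ba2 Cb2 ->]]]].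
exists (k + l)%N, (fun i => match split i with inl j => a1 j | inr j => a2 j end),
  (fun i => match split i with inl j => b1 j | inr j => b2 j end); split.
- by move=> i; case: split.
- by move=> i; case: split.
rewrite big_split_ord /=; congr (_ + _); apply: eq_bigr => i _.
  by have -> : split (lshift l i) = inl i by apply: (unsplitK (inl i)).
by have -> : split (rshift k i) = inr i by apply: (unsplitK (inr i)).
Qed.

Lemma prodK_sub B C B' C' : (forall b c, B b -> C c -> prodK B' C' (b * c)) ->
  prodK B C `<=` prodK B' C'.
Proof.
move=> BC x [n [b [c [Bb Cc ->]]]].
apply: (big_ind (prodK B' C')) => [|y z|i _]; last exact: BC.
  by exists 0, (fun=> 0), (fun=> 0); split=> [[]|[]|] //; rewrite big_ord0.
exact: prodKD.
Qed.

Lemma prodK_invK_sub B : prodK B (invK B) `<=` @baseK R.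
Proof.
move=> _ [n [b [c [Bb Cc ->]]]]; apply: (big_ind (@baseK R)).
- by exists 0; rewrite ?tofrac0.
- by move=> _ _ [a _ <-] [d _ <-]; exists (a + d); rewrite ?tofracD.
- by move=> i _; rewrite mulrC; apply: Cc.
Qed.

(** The t-closure of a subset of R stays in R and is stable under R, so it is
    R as soon as it contains 1. *)
Lemma tclosure_baseK B : B `<=` @baseK R ->
  (tclosure B = @baseK R <-> tclosure B 1).
Proof.
move=> BR; split=> [->|[J [Jfg J0 JB Jv]]]; first by exists 1; rewrite ?tofrac1.
apply/seteqP; split=> [x [J' [_ _ J'B J'x]]|_ [a _ <-]].
  rewrite -[x]mulr1; apply: J'x => y J'y; rewrite mul1r.
  exact/BR/J'B.
exists J; split=> // z Jz; apply: baseKM; first by exists a.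
by have := Jv z Jz; rewrite mul1r.
Qed.

Lemma tclosureS B C : B `<=` C -> tclosure B `<=` tclosure C.
Proof.
by move=> BC x [J [Jfg J0 JB Jx]]; exists J; split=> // y /JB/BC.
Qed.

(** Coefficients indexed by all natural numbers avoid transporting ordinals
    along equalities of sizes. *)
Lemma spanKP (s : seq K) x : spanK s x <->
  exists c : nat -> R, x = \sum_(i < size s) toK (c i) * s`_i.
Proof.
split=> [[c ->]|[c ->]]; last by exists (fun i => c i).
exists (fun k => if insub k is Some i then c i else 0).
by apply: eq_bigr => i _; rewrite valK.
Qed.

Lemma spanK_mem (s : seq K) x : x \in s -> spanK s x.
Proof.
move=> xs; have ix : (index x s < size s)%N by rewrite index_mem.
exists (fun i => (i == Ordinal ix)%:R); rewrite (bigD1 (Ordinal ix)) //=.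
rewrite eqxx tofrac1 mul1r nth_index // big1 ?addr0 // => i /negPf ->.
by rewrite tofrac0 mul0r.
Qed.

Lemma fin_gen_scale (t : K) J : fin_gen J -> fin_gen [set t * x | x in J].
Proof.
move=> [s ->]; exists [seq t * x | x <- s].
have scale (c : nat -> R) : t * (\sum_(i < size s) toK (c i) * s`_i) =
    \sum_(i < size [seq t * x | x <- s]) toK (c i) * [seq t * x | x <- s]`_i.
  rewrite size_map mulr_sumr; apply: eq_bigr => i _.
  by rewrite (nth_map 0) // mulrCA.
apply/seteqP; split=> [_ [_ /spanKP[c ->] <-]|_ /spanKP[c ->]].
  by apply/spanKP; exists c.
by rewrite -scale; eexists; [apply/spanKP; exists c|].
Qed.

(** Multiply together the multipliers of finitely many generators; primality
    keeps the product outside P. *)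
Lemma common_multiplier I P J : is_ideal I -> is_prime_ideal P -> fin_gen J ->
  (forall x, J x -> exists2 t, ~ P t & idealK I (toK t * x)) ->
  exists2 t, ~ P t & forall x, J x -> idealK I (toK t * x).
Proof.
move=> Iid /prime_mult_set[P1 PM] [s ->] loc.
have [t Pt ts] : exists2 t, ~ P t &
    forall x, x \in s -> idealK I (toK t * x).
  have {loc} : forall x, x \in s -> exists2 t, ~ P t & idealK I (toK t * x).
    by move=> x /spanK_mem/loc.
  elim: s => [|x s IHs] loc; first by exists 1.
  have [|t Pt ts] := IHs; first by move=> y ys; apply: loc; rewrite inE ys orbT.
  have [|u Pu ux] := loc x; first by rewrite inE eqxx.
  exists (t * u); first exact: PM.
  move=> y; rewrite inE tofracM => /predU1P[->|ys].
    by rewrite -mulrA; apply: idealKM.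
  by rewrite mulrAC mulrC; apply: idealKM => //; apply: ts.
exists t => // x [c ->]; rewrite mulr_sumr; apply: idealK_sum => // i.
by rewrite mulrCA; apply: idealKM => //; apply: ts; rewrite mem_nth.
Qed.

(** If J is a finitely generated subideal of P with 1 in J_v, choose t outside P
    with t J contained in I; then t lies in (t J)_v, hence in I_t = I, which is
    contained in P. *)
Lemma minimal_prime_tclosure1 I P : t_ideal I -> I = radical I ->
  minimal_primes I P -> ~ tclosure (idealK P) 1.
Proof.
move=> [Iid _ It] Irad IP [J [Jfg [x0 Jx0 x00] JP J1]].
have [Pp IsubP _] := IP; have [Pid P1 _] := (is_prime_idealP P).1 Pp.
have [|t Pt tJ] := common_multiplier I P J Iid Pp Jfg.
  move=> _ /JP[p Pp' <-].
  have [t Pt Itp] := minimal_prime_annihilated I P p Iid Irad IP Pp'.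
  by exists t => //; rewrite -tofracM; apply/idealK_toK.
apply/Pt/IsubP/idealK_toK; rewrite It.
exists [set toK t * x | x in J]; split.
- exact: fin_gen_scale.
- exists (toK t * x0); first by exists x0.
  rewrite mulf_neq0 // tofrac_eq0; apply/eqP => t0; apply: Pt.
  by rewrite t0; have /is_idealP[] := Pid.
- by move=> _ [x Jx <-]; apply: tJ.
- move=> z zJ; rewrite -[_ * _]mul1r; apply: J1 => x Jx.
  by rewrite mulrAC mulrC; apply: zJ; exists x.
Qed.

Lemma t_invertible_minimal_prime I P : t_ideal I -> I = radical I ->
  minimal_primes I P -> t_invertible (idealK P) ->
  exists p y, [/\ P p, invK (idealK P) y & ~ idealK P (y * toK p)].
Proof.
move=> It Irad IP Pinv; apply: contrapT => none.
have Pid : is_ideal P by case: IP => /is_prime_idealP[].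
apply: (minimal_prime_tclosure1 I P It Irad IP).
have : tclosure (prodK (idealK P) (invK (idealK P))) 1.
  by apply/tclosure_baseK; [exact: prodK_invK_sub|].
apply: tclosureS => _ [n [a [b [Pa Pb ->]]]]; apply: idealK_sum => // i.
have [p Pp <-] := Pa i; apply: contrapT => nP; apply: none.
by exists p, (b i); split=> //; rewrite mulrC.
Qed.

(** The ideal A = (p, r) is t-invertible, so it suffices that A A^-1 is
    contained in P P^-1.  Let u be in A^-1.  Then m = u p is in R, and
    m r = (u r) p is in P, whence m is in P because r is not.  As u r = m y,
    both generators of A are multiplied by u into P P^-1. *)
Lemma t_invertible_of_dual_escape P p y r : is_PVMD R -> is_prime_ideal P ->
  P p -> invK (idealK P) y -> y * toK p = toK r -> ~ P r ->
  t_invertible (idealK P).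
Proof.
move=> RP /is_prime_idealP[Pid P1 Pp] Ppp Py ypr Pr.
have [P0 _ PM] := (is_idealP P).1 Pid.
have r0 : r != 0 by apply/eqP => r0; apply: Pr; rewrite r0.
pose A := [set z | exists u v, z = u * p + v * r].
have Ap : A p by exists 1, 0; ring.
have Ar : A r by exists 0, 1; ring.
have Ainv : t_invertible (idealK A).
  apply: RP.
  - apply/is_idealP; split; first by exists 0, 0; ring.
      by move=> _ _ [u [v ->]] [u' [v' ->]]; exists (u + u'), (v + v'); ring.
    by move=> c _ [u [v ->]]; exists (c * u), (c * v); ring.
  - by exists r.
  - exists [:: toK p; toK r].
    have two (c : nat -> R) : toK (c 0 * p + c 1 * r) =
        \sum_(i < 2) toK (c i) * [:: toK p; toK r]`_i.
      by rewrite !big_ord_recl big_ord0 /= addr0 tofracD !tofracM.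
    apply/seteqP; split=> [_ [_ [u [v ->]] <-]|_ /spanKP[c ->]].
      by apply/spanKP; exists (nth 0 [:: u; v]); rewrite -two.
    by rewrite -two; eexists; [exists (c 0), (c 1)|].
apply/tclosure_baseK; first exact: prodK_invK_sub.
have : tclosure (prodK (idealK A) (invK (idealK A))) 1.
  by apply/tclosure_baseK; [exact: prodK_invK_sub|].
apply/tclosureS/prodK_sub => _ u [_ [c [d ->]] <-] Au.
have [m _ um] : baseK (u * toK p) by apply: Au; exists p.
have [k _ uk] : baseK (u * toK r) by apply: Au; exists r.
have Pm : P m.
  have : P (m * r).
    have -> : m * r = k * p.
      by apply: toK_inj; rewrite [LHS]tofracM [RHS]tofracM um uk mulrAC.
    exact: PM.
  by case/Pp.
have ur : u * toK r = toK m * y by rewrite -ypr um mulrA mulrAC.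
have -> : toK (c * p + d * r) * u = toK (c * m) * 1 + toK (d * m) * y.
  by rewrite [in LHS]tofracD !tofracM mulrDl -!mulrA -ur um; ring.
apply: prodKD; apply: mem_prodK => //; try by apply/idealK_toK/PM.
by move=> x /idealK_sub; rewrite mul1r.
Qed.

End Duals.

(** * Duals of radical t-ideals *)

Theorem theorem2p3 (R : idomainType) (I : set R)
    (hR : is_PVMD R)
    (hI : t_ideal I) (hrad : I = radical I)
    (hirr : irredundant (minimal_primes I)) :
  GRing.subring_closed [in invK (idealK I)] <->
  (forall P : set R, minimal_primes I P -> ~ t_invertible (idealK P)).
Proof.
have Iid : is_ideal I by case: hI.
split=> [[I1 IB IM] P IP Pinv|noinv].
  have [p [y [Pp Py yp]]] := t_invertible_minimal_prime I P hI hrad IP Pinv.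
  have [/is_prime_idealP[Pid P1 Pprime] IsubP _] := IP.
  have [j Pj Ij] := irredundant_witness I P Iid hrad hirr IP.
  have [r _ rE] : baseK (y * toK p) by apply: Py; exists p.
  have Pr : ~ P r by move=> Pr; apply: yp; rewrite -rE; apply/idealK_toK.
  have Iy : invK (idealK I) y.
    by move=> _ [a Ia <-]; apply: Py; exists a => //; apply: IsubP.
  have : invK (idealK I) (y * y).
    by have := IM y y; rewrite !in_setE; apply.
  move=> /(_ (toK (j * p))) [|k _ kE].
    by exists (j * p) => //; apply: Ij.
  have : P (j * (r * r)).
    have -> : j * (r * r) = k * p.
      by apply: toK_inj; rewrite !tofracM kE rE tofracM; ring.
    by have /is_idealP[_ _ PM] := Pid; apply: PM.
  by move=> /Pprime[//|/Pprime[]].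
(* I^-1 is stable under products because it equals (I : I). *)
have absorb x a : invK (idealK I) x -> I a -> idealK I (x * toK a).
  move=> Ix Ia.
  have [r _ rE] : baseK (x * toK a) by apply: Ix; exists a.
  rewrite -rE; apply/idealK_toK; rewrite -(bigcap_minimal_primes I Iid hrad).
  move=> P IP; apply: contrapT => Pr; apply: (noinv P IP).
  have [Pp IsubP _] := IP; have [_ _ Pprime] := (is_prime_idealP P).1 Pp.
  have [j Pj Ij] := irredundant_witness I P Iid hrad hirr IP.
  apply: (t_invertible_of_dual_escape P a (x * toK j) (j * r)) => //.
  - exact: IsubP.
  - move=> _ [p Pp' <-]; rewrite -mulrA -tofracM; apply: Ix.
    by exists (j * p) => //; apply: Ij.
  - by rewrite tofracM rE; ring.
  - by move=> /Pprime[].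
split; first by rewrite in_setE => x /idealK_sub; rewrite mul1r.
  move=> x y; rewrite !in_setE => Ix Iy a Ia; rewrite mulrBl.
  by apply: baseKB; [apply: Ix|apply: Iy].
move=> x y; rewrite !in_setE => Ix Iy _ [a Ia <-].
by rewrite -mulrA; apply: Ix; apply: absorb.
Qed.
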